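(* Let $M\ge2$ and $n\ge1$ be integers, let $(\mathcal X,\mu)$ be a measure space, and let $\mathcal P=\{p_1,\dots,p_M\}$ be a set of probability densities on $\mathcal X$ with respect to $\mu$. For any $\delta\in(0,1/2]$ there is a density estimator $\widehat p=\widehat p(X_1,\dots,X_n)$, with a choice not depending on $\delta$, such that for every probability density $p^\star$ on $(\mathcal X,\mu)$ (not assumed to belong to $\mathcal P$), if $X_1,\dots,X_n$ are i.i.d. with density $p^\star$, then with probability at least $1-\delta$, $$\mathrm{KL}(p^\star,\widehat p)\le\min_{1\le j\le M}\mathrm{KL}(p^\star,p_j)+\frac{19\log(2nM)\log(1/\delta)}{n}.$$
   Context: For probability densities $p,q$ on $(\mathcal X,\mu)$, $\mathrm{KL}(p,q)=\int_{\mathcal X}p\log(p/q)\,d\mu\in[0,+\infty]$ (equal to $+\infty$ if $p$ is not absolutely continuous with respect to $q$). A density estimator is a map from samples in $\mathcal X^n$ to probability densities on $(\mathcal X,\mu)$; it may depend on $\mathcal P$ and $n$, but not on $p^\star$. ''With a choice not depending on $\delta$'' means that one and the same estimator satisfies the bound for all $\delta\in(0,1/2]$. $\log$ is the natural logarithm. *)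

(* Defs.v *)
From HB Require Import structures.
From mathcomp Require Import all_boot all_order all_algebra.
From mathcomp Require Import all_classical all_reals all_analysis.

Set Implicit Arguments.
Unset Strict Implicit.
Unset Printing Implicit Defensive.

Import Order.TTheory GRing.Theory Num.Theory.
Import numFieldNormedType.Exports.

Local Open Scope classical_set_scope.
Local Open Scope ring_scope.

Section densities.
Context {d : measure_display} {T : measurableType d} {R : realType}.
Variable mu : {measure set T -> \bar R}.
Local Open Scope ereal_scope.

Definition density (p : T -> R) : Prop :=
  [/\ measurable_fun [set: T] p, (forall x, (0 <= p x)%R) &
      \int[mu]_x (p x)%:E = 1].

Definition law_of_density (p : T -> R) (A : set T) : \bar R :=
  \int[mu]_(x in A) (p x)%:E.

(* When [p] is absolutely continuous with respect to [q], the set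
   [{p > 0, q = 0}] is [mu]-null, and where [p] vanishes the integrand is
   [0 * ln 0 = 0]; so the junk values of [ln] and of division at 0 play no role.
   The negative part of the integrand is at most [q], hence integrable. *)
Definition KL (p q : T -> R) : \bar R :=
  if `[< law_of_density p `<< law_of_density q >]
  then \int[mu]_x (p x * ln (p x / q x))%:E
  else +oo.

Definition density_estimator (n : nat) (phat : n.-tuple T -> T -> R) : Prop :=
  forall s : n.-tuple T, density (phat s).

End densities.

Section iid.
Context {d d' : measure_display} {Omega : measurableType d'}
  {T : measurableType d} {R : realType}.
Variable P : probability Omega R.
Local Open Scope ereal_scope.

Definition mutually_independent (I : finType) (X : I -> {RV P >-> T}) : Prop :=
  forall (J : {set I}) (A : I -> set T),
    (forall i, i \in J -> measurable (A i)) ->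
    P (\bigcap_(i in [set` J]) (X i @^-1` A i)) =
    \prod_(i in J) P (X i @^-1` A i).

Definition iid_with_density (mu : {measure set T -> \bar R}) (p : T -> R)
    (I : finType) (X : I -> {RV P >-> T}) : Prop :=
  mutually_independent X /\
  forall i A, measurable A -> distribution P (X i) A = law_of_density mu p A.

End iid.

(* Main.v *)
(** Smooth the densities into [f_j = (1 - a) p_j + a (p_1 + ... + p_M) / M] with
    [a = 1/(2n)], so that all log-ratios are at most [B = ln (2nM)] in absolute
    value. Run exponential weights with the modified likelihoods
    [(f_j + m_t) / 2], where [m_t] is the current mixture; the weights then stay
    normalized and [prod_t (1 + f_j(X_t) / m_t(X_t)) / 2 <= M]. The estimator is
    the average of the [m_t].

    With [z = ln (f_j / m_t)], the quantity [2 ln ((1 + e^z) / 2)] exceeds [z] by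
    [2 ln cosh (z/2)], which pays for the variance in the exponential moment:
    [exp (- 2 s ln ((1 + e^z) / 2)) <= 1 - s z] for [s = 1 / (4B)]. Hence
    [prod_t exp (s D_t) ((1 + f_j(X_t) / m_t(X_t)) / 2)^(-2s)], where [D_t] is the
    conditional mean of [z], has expectation at most 1, and Markov's inequality
    gives [sum_t D_t <= 2 ln M + 4 B ln (1 / delta)] with probability [1 - delta].
    Concavity of [ln] bounds the excess risk by [(1 + sum_t D_t) / n], the term 1
    being the price of the smoothing. *)
Require Import Defs.
From HB Require Import structures.
From mathcomp Require Import all_boot all_order all_algebra.
From mathcomp Require Import all_classical all_reals all_analysis.
From mathcomp Require Import measurable_realfun lra ring.

Set Implicit Arguments.
Unset Strict Implicit.
Unset Printing Implicit Defensive.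

Import Order.TTheory GRing.Theory Num.Theory.
Import numFieldNormedType.Exports.

Local Open Scope classical_set_scope.
Local Open Scope ring_scope.

(** * An exponential inequality *)

Lemma is_derive_ln_comp (R : realType) (f : R -> R) (x df : R) : 0 < f x ->
  is_derive x (1 : R) f df -> is_derive x (1 : R) (@ln R \o f) (df / f x).
Proof.
move=> fx0 dfx; have dl := is_derive1_ln fx0.
have d1 : derivable (@ln R \o f) x 1.
  apply/derivable1_diffP; apply: differentiable_comp; apply/derivable1_diffP.
    exact: (@ex_derive _ _ _ _ _ _ _ dfx).
  exact: (@ex_derive _ _ _ _ _ _ _ dl).
split=> //.
rewrite -derive1E derive1_comp; [|exact: (@ex_derive _ _ _ _ _ _ _ dfx)|
  exact: (@ex_derive _ _ _ _ _ _ _ dl)].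
by rewrite !derive1E !derive_val mulrC.
Qed.

(** After taking logarithms the claim is [0 <= K z]. Here [K 0 = 0], and for [|t| <= |z|] the
    derivative [K' t] has the sign of [t], so the mean value theorem between 0 and [z] concludes.
    The condition on [lambda] also keeps [1 - lambda * t] positive there. *)
Lemma expR_softplus_le (R : realType) (lambda z : R) : 0 < lambda ->
  2 * lambda * (`|z| + 1) <= 1 ->
  expR (- (2 * lambda * ln ((1 + expR z) / 2))) <= 1 - lambda * z.
Proof.
move=> l0 lz.
pose u (t : R) := 1 - lambda * t.
pose v (t : R) := 2^-1 * (1 + expR t).
pose K (t : R) := ln (u t) + (2 * lambda) * ln (v t).
pose K' (t : R) := - lambda / u t
  + 2 * lambda * (2^-1 * expR t / v t).
have tz1 t : `|t| <= `|z| -> 0 < u t.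
  move=> tz; have tt : t <= `|t| := ler_norm t.
  have : 0 <= lambda * (`|z| - t) by apply: mulr_ge0; lra.
  by rewrite /u; lra.
have v0 t : 0 < v t by have := expR_gt0 t; rewrite /v; lra.
have drvK t : `|t| <= `|z| -> is_derive t (1 : R) K (K' t).
  move=> /tz1 t0.
  have du : is_derive t (1 : R) u (- lambda).
    have : is_derive t (1 : R) (cst 1 - lambda *: @id R) (0 - lambda *: 1).
      exact: is_deriveB.
    by rewrite sub0r /GRing.scale/= mulr1.
  have dv : is_derive t (1 : R) v (2^-1 * expR t).
    have : is_derive t (1 : R) (2^-1 *: (cst 1 + @expR R)) (2^-1 *: (0 + expR t)).
      exact: is_deriveZ.
    by rewrite add0r.
  have dlu := is_derive_ln_comp t0 du.
  have dlv := is_derive_ln_comp (v0 t) dv.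
  have : is_derive t (1 : R) ((@ln R \o u) + (2 * lambda) *: (@ln R \o v)) (K' t).
    by apply: is_deriveD.
  by [].
have K0 : K 0 = 0.
  rewrite /K /u /v mulr0 subr0 ln1 expR0 add0r.
  by rewrite (_ : 2^-1 * (1 + 1) = 1) ?ln1 ?mulr0//; lra.
have contK a b : (forall t, t \in `[a, b] -> `|t| <= `|z|) ->
    {within `[a, b], continuous K}.
  move=> ab; apply: derivable_within_continuous => t tab.
  exact: (@ex_derive _ _ _ _ _ _ _ (drvK t (ab t tab))).
suff Kz : 0 <= K z.
  rewrite -[leRHS]lnK ?posrE ?tz1// ler_expR.
  by move: Kz; rewrite /K /v /u [_^-1 * _]mulrC; lra.
(* Over a common denominator, which is positive, only the sign of
   [expR t * (1 - 2 * lambda * t) - 1] matters. *)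
have K'E t : 0 < u t ->
    K' t = lambda * (expR t * (1 - 2 * lambda * t) - 1) / (u t * (1 + expR t)).
  move=> ut; rewrite /K' /v; have e0 := expR_gt0 t.
  have -> : expR t * (1 - 2 * lambda * t) - 1 = 2 * u t * expR t - (1 + expR t).
    by rewrite /u; ring.
  by field; rewrite !gt_eqF//; lra.
have [z0|z0] := leP 0 z.
  have ab t : t \in `[0, z] -> 0 <= t /\ `|t| <= `|z|.
    by rewrite in_itv/= => /andP[? ?]; rewrite !ger0_norm.
  have [||c /ab[c0 cz]] := @MVT_segment R K K' 0 z z0.
  - move=> t tz; apply: drvK; apply: (ab _ _).2.
    exact: (subset_itv_oo_cc tz).
  - by apply: contK => t /ab[].
  rewrite K0 !subr0 => ->; apply: mulr_ge0 => //; rewrite K'E ?tz1//.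
  (* Since [expR c >= 1 + c], the numerator is at least [(1 + c) * (1 - 2 * lambda * c) - 1 = c * (1
     - 2 * lambda * (c + 1))]. *)
  have e0 := expR_ge1Dx c.
  apply: divr_ge0; last by apply: mulr_ge0; [exact/ltW/tz1|lra].
  apply: mulr_ge0; first exact: ltW.
  have lc : 0 <= 1 - 2 * lambda * (c + 1).
    have : 0 <= lambda * (`|z| - c).
      by apply: mulr_ge0; [exact: ltW|move: cz; rewrite (ger0_norm c0); lra].
    by lra.
  have : 0 <= c * (1 - 2 * lambda * (c + 1)) by exact: mulr_ge0.
  have : 0 <= (expR c - (1 + c)) * (1 - 2 * lambda * c).
    by apply: mulr_ge0; [rewrite subr_ge0|lra].
  by lra.
have ab t : t \in `[z, 0] -> t <= 0 /\ `|t| <= `|z|.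
  by rewrite in_itv/= => /andP[? ?]; rewrite !ler0_norm ?lerN2// ltW.
have [||c /ab[c0 cz]] := @MVT_segment R K K' z 0 (ltW z0).
- move=> t tz; apply: drvK; apply: (ab _ _).2.
  exact: (subset_itv_oo_cc tz).
- by apply: contK => t /ab[].
rewrite K0 !sub0r => Kzc; rewrite -oppr_le0 Kzc; apply: mulr_le0_ge0; last lra.
rewrite K'E ?tz1//; have e0 := expR_gt0 c; have e1 := expR_ge1Dx (- c).
apply: mulr_le0_ge0; last first.
  by rewrite invr_ge0; apply: mulr_ge0; [exact/ltW/tz1|lra].
apply: mulr_ge0_le0; first exact: ltW.
(* Dividing by [expR c] leaves [1 - 2 * lambda * c <= expR (- c)], which follows from
   [1 - c <= expR (- c)] and [2 * lambda <= 1]. *)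
rewrite subr_le0 -[leRHS](expRxMexpNx_1 c) ler_pM2l//.
have : 0 <= - c * (1 - 2 * lambda).
  apply: mulr_ge0; first lra.
  have : 0 <= lambda * `|z| by apply: mulr_ge0; [exact: ltW|].
  by lra.
by lra.
Qed.

(** * Change of density *)

Section change_of_density.
Context d (T : measurableType d) (R : realType).
Variables (mu nu : {measure set T -> \bar R}) (p : T -> R).
Hypotheses (mp : measurable_fun [set: T] p) (p0 : forall x, 0 <= p x).
Hypothesis nuE : forall A, measurable A -> nu A = law_of_density mu p A.
Local Open Scope ereal_scope.
Import HBNNSimple.

Let mpE : measurable_fun [set: T] (fun x => (p x)%:E).
Proof. exact/measurable_EFinP. Qed.

Let nnsfun_change_of_density (h : {nnsfun T >-> R}) :
  \int[nu]_x (h x)%:E = \int[mu]_x ((h x)%:E * (p x)%:E).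
Proof.
have mi r : measurable_fun [set: T] (fun x => (r * \1_(h @^-1` [set r]) x)%:E).
  by apply/measurable_EFinP/measurable_funM => //; exact: measurable_indic.
have i0 r x : 0 <= (r * \1_(h @^-1` [set r]) x)%:E.
  by rewrite EFinM nnfun_muleindic_ge0.
under eq_integral do rewrite fimfunE -fsumEFin//.
rewrite ge0_integral_fsum//.
under [RHS]eq_integral => x _.
  rewrite fimfunE -fsumEFin// ge0_mule_fsuml//.
  over.
rewrite ge0_integral_fsum//; last 2 first.
- by move=> r; exact: emeasurable_funM.
- by move=> r x _; apply: mule_ge0; rewrite // lee_fin.
apply: eq_fsbigr => r /[!inE] -[t _ <-].
under eq_integral do rewrite EFinM.
under [RHS]eq_integral do rewrite EFinM -muleA.
have mI : measurable_fun [set: T] (fun x => (\1_(h @^-1` [set h t]) x : R)%:E).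
  by apply/measurable_EFinP; exact: measurable_indic.
rewrite !ge0_integralZl ?lee_fin//; first last.
- by move=> x _; rewrite mule_ge0 ?lee_fin.
- exact: emeasurable_funM.
congr *%E; rewrite integral_indic// setIT nuE// /law_of_density integral_mkcond.
by apply: eq_integral => x _; rewrite epatch_indic muleC.
Qed.

(** Simple functions increase to [f], and monotone convergence applies under both measures. *)
Lemma ge0_change_of_density (f : T -> \bar R) : measurable_fun [set: T] f ->
  (forall x, 0 <= f x) -> \int[nu]_x f x = \int[mu]_x (f x * (p x)%:E).
Proof.
move=> mf f0; pose h := nnsfun_approx measurableT mf.
transitivity (limn (fun n => \int[nu]_x (h n x)%:E)).
  rewrite -monotone_convergence//.
  - apply: eq_integral => x _; apply/esym/cvg_lim => //.
    exact: cvg_nnsfun_approx.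
  - by move=> n; apply/measurable_EFinP.
  - by move=> n x _; rewrite lee_fin.
  - by move=> x _ a b ab; rewrite lee_fin; exact/lefP/nd_nnsfun_approx.
under eq_fun do rewrite nnsfun_change_of_density.
rewrite -monotone_convergence//.
- apply: eq_integral => x _; apply/cvg_lim => //.
  by apply: cvgeZr => //; exact: cvg_nnsfun_approx.
- by move=> n; apply: emeasurable_funM => //; apply/measurable_EFinP.
- by move=> n x _; rewrite mule_ge0 ?lee_fin.
- move=> x _ a b ab; rewrite lee_wpmul2r ?lee_fin//.
  exact/lefP/nd_nnsfun_approx.
Qed.

(** Each integral is that of the positive part minus that of the negative part, and multiplication
    by [p >= 0] commutes with taking these parts. *)
Lemma change_of_density (f : T -> R) : measurable_fun [set: T] f ->
  \int[mu]_x (p x * f x)%:E = \int[nu]_x (f x)%:E.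
Proof.
move=> mf; have mfE : measurable_fun setT (fun x => (f x)%:E) by exact/measurable_EFinP.
rewrite [LHS]integralE [RHS]integralE.
rewrite (ge0_change_of_density (measurable_funepos mfE))//.
rewrite (ge0_change_of_density (measurable_funeneg mfE))//.
congr (_ - _); apply: eq_integral => x _.
- rewrite !funeposE -!EFin_max -EFinM maxr_pMl// mul0r.
  by rewrite mulrC.
- rewrite !funenegE -!EFinN -!EFin_max -EFinM maxr_pMl// mul0r.
  by rewrite mulNr mulrC.
Qed.

End change_of_density.

(** * Independence *)

(** Boxes, unlike preimages under single coordinates, are stable under intersection, as uniqueness
    of measures requires. A coordinate preimage is a box with at most one proper side, and a box is
    a finite intersection of such preimages. *)
Lemma measurable_tuple_boxE d (T : measurableType d) n :
  @measurable _ (n.-tuple T) =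
  <<s [set B | exists A : 'I_n -> set T, (forall i, measurable (A i)) /\
        B = [set v | forall i, A i (tnth v i)]] >>.
Proof.
apply/seteqP; split.
- apply: smallest_sub; first exact: smallest_sigma_algebra.
  rewrite -bigcup_seq => _ [i _ [A mA <-]]; apply: sub_sigma_algebra.
  exists (fun j => if j == i then A else setT); split.
    by move=> j; case: ifP.
  rewrite setTI; apply/seteqP; split=> v /= vA.
    by move=> j; case: eqP => // ->.
  by have := vA i; rewrite eqxx.
- apply: smallest_sub; first exact: sigma_algebra_measurable.
  move=> _ [A [mA ->]].
  rewrite (_ : [set v | _] = \bigcap_(i in [set: 'I_n]) ((@tnth n T ^~ i) @^-1` A i)).
    apply: fin_bigcap_measurable => //= i _; rewrite -[X in measurable X]setTI.
    exact: measurable_tnth.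
  by apply/seteqP; split=> v /= vA i => [_|]; apply: vA.
Qed.

Section independence.
Context d d' (Omega : measurableType d') (T : measurableType d) (R : realType).
Variables (P : probability Omega R) (nu : probability T R).
Variables (k : nat) (Y : nat -> {mfun Omega >-> T}).
Local Open Scope ereal_scope.

Hypothesis YE : forall A : nat -> set T, (forall i, measurable (A i)) ->
  P [set w | forall i, (i < k.+1)%N -> A i (Y i w)] = \prod_(i < k.+1) nu (A i).

Let V w : k.-tuple T := [tuple Y i w | i < k].

Let mV : measurable_fun [set: Omega] V.
Proof.
apply/measurable_fun_tnthP => i; rewrite (_ : _ \o _ = Y i)//.
by apply/funext => w /=; rewrite tnth_mktuple.
Qed.

Let Vm : {mfun Omega >-> k.-tuple T} :=
  HB.pack V (isMeasurableFun.Build _ _ _ _ _ mV).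

(** For fixed [B] both sides are finite measures in [A]; they agree on boxes by [YE], hence
    everywhere. *)
Let indep_rect (A : set (k.-tuple T)) (B : set T) :
  measurable A -> measurable B ->
  P (V @^-1` A `&` Y k @^-1` B) = P (V @^-1` A) * nu B.
Proof.
move=> mA mB.
have mYB : measurable (Y k @^-1` B) by rewrite -[X in measurable X]setTI; exact: measurable_funP.
have nuB : (0 <= fine (nu B))%R by exact: fine_ge0.
pose m1 := pushforward (mrestr P mYB) Vm.
pose m2 := mscale (NngNum nuB) (distribution P Vm).
have nuBE : nu B = (fine (nu B))%:E by rewrite fineK// fin_num_measure.
suff : m1 A = m2 A by rewrite /m1 /m2 /mscale /distribution /pushforward/= -nuBE muleC.
apply: (measure_unique _ (fun _ => setT) (measurable_tuple_boxE T k)) => //.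
- move=> _ _ [A1 [mA1 ->]] [A2 [mA2 ->]].
  exists (fun i => A1 i `&` A2 i); split=> [i|]; first exact: measurableI.
  apply/seteqP; split=> v /=; first by move=> [v1 v2] i; split.
  by move=> vA; split=> i; have [] := vA i.
- by move=> _; exists (fun=> setT); split=> //; apply/seteqP; split.
- by apply/seteqP; split=> // v _; exists 0%N.
- move=> _ [C [mC ->]].
  (* The sides of the box at indices below [k], followed by [C'] at index [k]. *)
  pose D (C' : set T) (i : nat) := if insub i is Some j then C j else C'.
  have mD C' : measurable C' -> forall i, measurable (D C' i).
    by move=> mC' i; rewrite /D; case: insubP.
  have DE C' : measurable C' ->
      P [set w | forall i, (i < k.+1)%N -> D C' i (Y i w)] =
      \prod_(i < k) nu (C i) * nu C'.
    move=> mC'; rewrite YE; last exact: mD.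
    rewrite big_ord_recr/= {2}/D insubF ?ltnn//; congr (_ * _).
    by apply: eq_bigr => i _; rewrite /D/= valK.
  have DY C' : [set w | forall i, (i < k.+1)%N -> D C' i (Y i w)] =
      V @^-1` [set v | forall i, C i (tnth v i)] `&` Y k @^-1` C'.
    apply/seteqP; split=> w /=.
      move=> DYw; split=> [i|].
        by have := DYw i (ltnW (ltn_ord i)); rewrite /D valK tnth_mktuple.
      by have := DYw k (ltnSn k); rewrite /D insubF ?ltnn.
    move=> [Cw C'w] i; rewrite ltnS leq_eqVlt => /predU1P[->|ik].
      by rewrite /D insubF ?ltnn.
    by rewrite /D insubT; have := Cw (Ordinal ik); rewrite tnth_mktuple.
  rewrite -[LHS]/(P (V @^-1` _ `&` Y k @^-1` B)).
  rewrite -[RHS]/((fine (nu B))%:E * P (V @^-1` _)) -nuBE.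
  rewrite -DY DE// muleC; congr (_ * _).
  (* With [setT] as last side, the product formula gives the law of [V] on the box. *)
  by have := DE _ measurableT; rewrite DY preimage_setT setIT probability_setT mule1.
- move=> _; rewrite -[ltLHS]/(P (V @^-1` setT `&` Y k @^-1` B)).
  by rewrite preimage_setT setTI (le_lt_trans (probability_le1 _ _)) ?ltry.
Qed.

(** The joint law of [V] and [Y k] is the product measure, so Tonelli applies. This replaces
    conditioning on the past: the past is frozen and a fresh observation integrated out. *)
Lemma indep_integral (f : k.-tuple T * T -> \bar R) :
  measurable_fun [set: k.-tuple T * T] f -> (forall z, 0 <= f z) ->
  \int[P]_w f (V w, Y k w) = \int[P]_w \int[nu]_x f (V w, x).
Proof.
move=> mf f0.
have mVY : measurable_fun [set: Omega] (fun w => (V w, Y k w)).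
  by apply: measurable_fun_pair => //; exact: measurable_funP.
pose VY : {mfun Omega >-> (k.-tuple T * T)%type} :=
  HB.pack (fun w => (V w, Y k w)) (isMeasurableFun.Build _ _ _ _ _ mVY).
have E : forall S, measurable S -> (distribution P Vm \x nu) S = distribution P VY S.
  apply: product_measure_unique => A B mA mB.
  exact: indep_rect.
transitivity (\int[distribution P VY]_z f z).
  by rewrite ge0_integral_distribution.
transitivity (\int[distribution P Vm \x nu]_z f z).
  by apply: eq_measure_integral => S mS _; exact: esym (E S mS).
rewrite fubini_tonelli1// ge0_integral_distribution//.
  exact: measurable_fun_fubini_tonelli_F.
by move=> v; exact: integral_ge0.
Qed.

End independence.

(** * Sequential products *)

(** The factorization through [x ^+ 2] reduces the inverse to a real power of a nonnegative number;
    it persists at 0, where both sides are 0. *)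
Lemma inv_measurable (R : realType) : measurable_fun [set: R] (@GRing.inv R).
Proof.
rewrite (_ : GRing.inv = fun x : R => x * (x ^+ 2) `^ (-1)).
  apply: measurable_funM => //.
  exact: (measurableT_comp (measurable_powR (-1)) (@exprn_measurable R setT 2)).
apply/funext => x; rewrite powR_inv1 ?sqr_ge0//.
have [->|x0] := eqVneq x 0; first by rewrite invr0 mul0r.
by field.
Qed.

Lemma measurable_funV d (T : measurableType d) (R : realType) (f : T -> R) :
  measurable_fun [set: T] f -> measurable_fun [set: T] (fun x => (f x)^-1).
Proof. by move=> mf; apply: measurableT_comp => //; exact: inv_measurable. Qed.

Lemma measurable_integral_snd d1 d2 (S : measurableType d1)
    (T : measurableType d2) (R : realType) (nu : probability T R)
    (f : S * T -> R) : measurable_fun [set: S * T] f ->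
  measurable_fun [set: S] (fun s => \int[nu]_x (f (s, x))%:E)%E.
Proof.
move=> mf.
have mfE : measurable_fun [set: S * T] (fun z => (f z)%:E) by exact/measurable_EFinP.
under eq_fun do rewrite integralE.
apply: emeasurable_funB.
- under eq_fun do under eq_integral do rewrite funeposE -(funeposE (fun z => (f z)%:E)).
  by apply: measurable_fun_fubini_tonelli_F => //; exact: measurable_funepos.
- under eq_fun do under eq_integral do rewrite funenegE -(funenegE (fun z => (f z)%:E)).
  by apply: measurable_fun_fubini_tonelli_F => //; exact: measurable_funeneg.
Qed.

(** The positive parts are ordered like [f] and [g], the negative parts the other way, so the
    comparison also covers infinite integrals. *)
Lemma ae_le_integral d (T : measurableType d) (R : realType)
    (mu : {measure set T -> \bar R}) (f g : T -> \bar R) :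
  measurable_fun [set: T] f -> measurable_fun [set: T] g ->
  {ae mu, forall x, f x <= g x}%E -> (\int[mu]_x f x <= \int[mu]_x g x)%E.
Proof.
move=> mf mg fg; rewrite integralE [leRHS]integralE; apply: leeB.
- apply: ae_ge0_le_integral => //; [exact: measurable_funepos|exact: measurable_funepos|].
  apply: filterS fg => x fg _; rewrite !funeposE.
  by rewrite ge_max le_max fg/= le_max lexx orbT.
- apply: ae_ge0_le_integral => //; [exact: measurable_funeneg|exact: measurable_funeneg|].
  apply: filterS fg => x fg _; rewrite !funenegE.
  by rewrite ge_max !le_max leeN2 fg/= lexx orbT.
Qed.

Section sequential_product.
Context d d' (Omega : measurableType d') (T : measurableType d) (R : realType).
Variables (P : probability Omega R) (nu : probability T R).
Variables (n : nat) (Y : nat -> {mfun Omega >-> T}).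
Variable phi : nat -> (nat -> T) -> T -> R.
Local Open Scope ereal_scope.

Hypothesis YE : forall k (A : nat -> set T), (k <= n)%N ->
  (forall i, measurable (A i)) ->
  P [set w | forall i, (i < k)%N -> A i (Y i w)] = \prod_(i < k) nu (A i).
Hypothesis phi0 : forall i u x, (0 <= phi i u x)%R.
Hypothesis phi_ext : forall i u v, (forall l, (l < i)%N -> u l = v l) ->
  phi i u =1 phi i v.
Hypothesis mphi : forall i d1 (S : measurableType d1) (U : S -> nat -> T),
  (forall l, measurable_fun [set: S] (U ^~ l)) ->
  measurable_fun [set: S * T] (fun z => phi i (U z.1) z.2).
Hypothesis phi1 : forall i u, \int[nu]_x (phi i u x)%:E <= 1.

(** A supermartingale argument: factor [k] depends on the past only through the first [k]
    observations and has conditional mean at most 1, so the last factor can be integrated out first.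
    The hypothesis [mphi] allows any parametrization of the past because it is applied both to
    tuples and to points of [Omega]. *)
Lemma sequential_product_le1 k : (k <= n)%N ->
  \int[P]_w (\prod_(i < k) phi i (Y ^~ w) (Y i w))%:E <= 1.
Proof.
elim: k => [_|k IH kn].
  under eq_integral do rewrite big_ord0.
  by rewrite integral_cst// mul1e; exact: probability_le1.
(* Padding with [point] turns a tuple into a sequence; by [phi_ext] the factors up to index [k] do
   not see the padding. *)
pose U (v : k.-tuple T) (i : nat) : T := nth point v i.
have mU i : measurable_fun [set: k.-tuple T] (U ^~ i).
  have [ik|ik] := ltnP i k; last first.
    rewrite (_ : U ^~ i = cst point)//; apply/funext => v.
    by rewrite /U nth_default ?size_tuple.
  rewrite (_ : U ^~ i = (@tnth _ T ^~ (Ordinal ik))); first exact: measurable_tnth.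
  by apply/funext => v; rewrite /U (tnth_nth point).
pose A (u : nat -> T) : R := (\prod_(i < k) phi i u (u i))%R.
have A0 u : (0 <= A u)%R by apply: prodr_ge0.
have mA : measurable_fun [set: k.-tuple T] (fun v => A (U v)).
  apply: measurable_prod => i _.
  apply: (@measurableT_comp _ _ _ _ _ _ (fun z => phi i (U z.1) z.2) _
    (fun v => (v, U v i))); first exact: mphi.
  exact: measurable_fun_pair.
pose f (z : k.-tuple T * T) := (A (U z.1) * phi k (U z.1) z.2)%:E.
have mf : measurable_fun [set: k.-tuple T * T] f.
  apply/measurable_EFinP/measurable_funM; last exact: mphi.
  exact: measurableT_comp mA measurable_fst.
have f0 z : 0 <= f z by rewrite lee_fin mulr_ge0.
pose V w := [tuple Y i w | i < k].
have mV : measurable_fun [set: Omega] V.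
  apply/measurable_fun_tnthP => i; rewrite (_ : _ \o _ = Y i)//.
  by apply/funext => w /=; rewrite tnth_mktuple.
have VE w l : (l < k)%N -> Y l w = U (V w) l.
  by move=> lk; rewrite /U /V (nth_mktuple _ _ (Ordinal lk)).
have AE w : A (Y ^~ w) = A (U (V w)).
  apply: eq_bigr => i _; rewrite -VE//; apply: phi_ext => l li; apply: VE.
  exact: ltn_trans li _.
under eq_integral do rewrite big_ord_recr/= -/(A _) AE (phi_ext (VE _)).
rewrite (indep_integral (fun A mA => YE kn mA) mf f0).
apply: le_trans (IH (ltnW kn)); apply: ge0_le_integral => //.
- by move=> w _; exact: integral_ge0.
- exact: (measurableT_comp (@measurable_fun_fubini_tonelli_F _ _ _ _ _ nu f mf f0) mV).
- apply/measurable_EFinP/measurable_prod => i _.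
  have mphiY : measurable_fun [set: Omega * T]
    (fun z => phi i (fun l => Y l z.1) z.2) by exact: (@mphi i _ _ (fun w l => Y l w)).
  have mwY : measurable_fun [set: Omega] (fun w => (w, Y i w)).
    exact: measurable_fun_pair.
  exact: measurableT_comp mphiY mwY.
move=> w _; rewrite -/(A (Y ^~ w)) AE /f/=.
under eq_integral do rewrite EFinM.
rewrite ge0_integralZl_EFin//; first by rewrite -[leRHS]mule1 lee_wpmul2l ?lee_fin.
- by move=> x _; rewrite lee_fin.
- apply/measurable_EFinP.
  apply: (@measurableT_comp _ _ _ _ _ _ (fun z => phi k (U z.1) z.2) _
    (fun x => (V w, x))); first exact: mphi.
  exact: measurable_fun_pair.
Qed.

End sequential_product.

(** * Exponential weights with modified likelihoods *)

Section sequential_mixture.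
Context (R : realType) (M : nat) (T : Type).
Implicit Types (w : 'I_M -> R) (g : 'I_M -> T -> R) (u v : nat -> T).

Definition mixture w g (x : T) : R := \sum_(j < M) w j * g j x.

Fixpoint weight g u (t : nat) : 'I_M -> R :=
  if t is t'.+1 then
    fun j => weight g u t' j *
      ((1 + g j (u t') / mixture (weight g u t') g (u t')) / 2)
  else fun=> M%:R^-1.

Definition lik_ratio g u t j x : R := g j x / mixture (weight g u t) g x.

Lemma weight_ext g u v t : (forall l, (l < t)%N -> u l = v l) ->
  weight g u t = weight g v t.
Proof.
elim: t => [//|t IH] uv /=; apply/funext => j.
by rewrite IH ?uv// => l lt; apply: uv; exact: ltnW.
Qed.

Variables (F : 'I_M -> T -> R) (C : R).
Hypotheses (M0 : (0 < M)%N) (F0 : forall j x, 0 < F j x).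
Hypothesis C1 : 1 <= ln C.
Hypothesis FC : forall j k x, F j x <= C * F k x.

Lemma mixture_le w j x : (forall k, 0 <= w k) -> \sum_k w k = 1 ->
  mixture w F x <= C * F j x.
Proof.
move=> w0 w1; rewrite -[leRHS]mul1r -w1 mulr_suml; apply: ler_sum => k _.
exact: ler_wpM2l.
Qed.

Lemma le_mixture w j x : (forall k, 0 <= w k) -> \sum_k w k = 1 ->
  F j x <= C * mixture w F x.
Proof.
move=> w0 w1; rewrite -[leLHS]mul1r -w1 mulr_suml mulr_sumr; apply: ler_sum => k _.
by rewrite mulrCA; exact: ler_wpM2l.
Qed.

Let C0 : 0 < C.
Proof.
(* At nonpositive arguments [ln] takes the default value 0, which [1 <= ln C] excludes. *)
rewrite ltNge; apply/negP => C0; move: C1.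
by rewrite ln0// leNgt ltr01.
Qed.

Lemma mixture_gt0 w x : (forall k, 0 <= w k) -> \sum_k w k = 1 ->
  0 < mixture w F x.
Proof.
move=> w0 w1; rewrite -(pmulr_rgt0 _ C0).
exact: lt_le_trans (F0 (Ordinal M0) x) (le_mixture _ _ w0 w1).
Qed.

(** The update turns total mass 1 into [(1 + m / m) / 2 = 1], where [m] is the current mixture at
    the new observation; positivity of [m] makes the quotient genuine. *)
Lemma weight_simplex u t :
  (forall j, 0 <= weight F u t j) /\ \sum_j weight F u t j = 1.
Proof.
elim: t => [|t [w0 w1]] /=.
  split=> [j|]; first by rewrite invr_ge0.
  by rewrite sumr_const card_ord -[_ *+ _]mulr_natr mulVf// pnatr_eq0 -lt0n.
have m0 := mixture_gt0 (u t) w0 w1.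
split=> [j|].
  rewrite mulr_ge0 ?divr_ge0// addr_ge0// divr_ge0//; exact/ltW.
under eq_bigr do rewrite mulrA mulrDr mulr1 mulrA.
rewrite -mulr_suml big_split/= w1 -mulr_suml -/(mixture _ _ _) divff ?gt_eqF//.
by field.
Qed.

Lemma lik_ratio_gt0 u t j x : 0 < lik_ratio F u t j x.
Proof.
have [w0 w1] := weight_simplex u t.
by rewrite divr_gt0// mixture_gt0.
Qed.

Lemma abs_ln_lik_ratio u t j x : `|ln (lik_ratio F u t j x)| <= ln C.
Proof.
have [w0 w1] := weight_simplex u t; have m0 := mixture_gt0 x w0 w1.
rewrite ler_norml -lnV ?posrE// !ler_ln ?posrE ?invr_gt0 ?lik_ratio_gt0//.
rewrite ler_pdivrMr// le_mixture// andbT ler_pdivlMr// mulrC ler_pdivrMr//.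
by rewrite mulrC mixture_le.
Qed.

(** The product divided by [M] is the weight of [j] after [t] steps, and a weight in the simplex is
    at most 1. *)
Lemma prod_lik_ratio_le u t j :
  \prod_(i < t) ((1 + lik_ratio F u i j (u i)) / 2) <= M%:R.
Proof.
have wE : weight F u t j = M%:R^-1 * \prod_(i < t) ((1 + lik_ratio F u i j (u i)) / 2).
  elim: t => [|t IH]; first by rewrite big_ord0 mulr1.
  by rewrite big_ord_recr [RHS]mulrA -IH.
have [w0 w1] := weight_simplex u t.
have : weight F u t j <= 1 by rewrite -w1 (bigD1 j)//= lerDl sumr_ge0.
by rewrite wE mulrC ler_pdivrMr ?mul1r// ltr0n.
Qed.

End sequential_mixture.

(** * Measurability of weights and likelihood ratios *)

Section mixture_measurable.
Context d (T : measurableType d) (R : realType) (M : nat).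
Variable g : 'I_M -> T -> R.
Hypothesis mg : forall j, measurable_fun [set: T] (g j).

Lemma measurable_mixture d1 (S : measurableType d1) (w : S -> 'I_M -> R)
    (f : S -> T) : (forall j, measurable_fun [set: S] (w ^~ j)) ->
  measurable_fun [set: S] f -> measurable_fun [set: S] (fun s => mixture (w s) g (f s)).
Proof.
move=> mw mf; apply: measurable_sum => j; apply: measurable_funM => //.
exact: measurableT_comp (mg j) mf.
Qed.

Lemma measurable_weight d1 (S : measurableType d1) (U : S -> nat -> T) t j :
  (forall l, measurable_fun [set: S] (U ^~ l)) ->
  measurable_fun [set: S] (fun s => weight g (U s) t j).
Proof.
move=> mU; elim: t j => [|t IH] j /=; first exact: measurable_cst.
apply: measurable_funM => //; apply: measurable_funM => //.
apply: measurable_funD => //; apply: measurable_funM.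
  exact: measurableT_comp (mg j) (mU t).
by apply: measurable_funV; exact: measurable_mixture.
Qed.

Lemma measurable_lik_ratio d1 (S : measurableType d1) (U : S -> nat -> T)
    (f : S -> T) t j : (forall l, measurable_fun [set: S] (U ^~ l)) ->
  measurable_fun [set: S] f ->
  measurable_fun [set: S] (fun s => lik_ratio g (U s) t j (f s)).
Proof.
move=> mU mf; apply: measurable_funM; first exact: measurableT_comp (mg j) mf.
apply: measurable_funV; apply: measurable_mixture => // k.
exact: measurable_weight.
Qed.

End mixture_measurable.

(** * The deviation inequality for the sum of conditional means *)

Section sequential_deviation.
Context d d' (Omega : measurableType d') (T : measurableType d) (R : realType).
Variables (P : probability Omega R) (nu : probability T R).
Variables (n : nat) (Y : nat -> {mfun Omega >-> T}).
Hypothesis YE : forall k (A : nat -> set T), (k <= n)%N ->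
  (forall i, measurable (A i)) ->
  P [set w | forall i, (i < k)%N -> A i (Y i w)] = (\prod_(i < k) nu (A i))%E.
Variables (M : nat) (F : 'I_M -> T -> R) (C : R).
Hypotheses (M0 : (0 < M)%N) (F0 : forall j x, 0 < F j x).
Hypothesis mF : forall j, measurable_fun [set: T] (F j).
Hypothesis C1 : 1 <= ln C.
Hypothesis FC : forall j k x, F j x <= C * F k x.
Variable j : 'I_M.

(** The conditional mean [D_t], with the past [u] frozen. In the setting of this section the
    integrand is bounded by [ln C], so [fine] is applied to a finite value. *)
Definition mean_log_ratio (u : nat -> T) (t : nat) : R :=
  fine (\int[nu]_x (ln (lik_ratio F u t j x))%:E)%E.

Let ml d1 (S : measurableType d1) (U : S -> nat -> T) (f : S -> T) t :
  (forall l, measurable_fun [set: S] (U ^~ l)) ->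
  measurable_fun [set: S] f ->
  measurable_fun [set: S] (fun s => ln (lik_ratio F (U s) t j (f s))).
Proof.
move=> mU mf; apply: measurableT_comp; first exact: measurable_ln.
exact: measurable_lik_ratio.
Qed.

Lemma integrable_ln_lik_ratio u t :
  nu.-integrable [set: T] (fun x => (ln (lik_ratio F u t j x))%:E).
Proof.
apply: measurable_bounded_integrable => //.
- by rewrite (le_lt_trans (probability_le1 _ _)) ?ltry.
- exact: (@ml _ T (fun=> u) id).
- exists (ln C); split; first exact: num_real.
  move=> B CB x _ /=; apply: le_trans (ltW CB).
  exact: (abs_ln_lik_ratio M0 F0 C1 FC).
Qed.

Lemma mean_log_ratioE u t :
  (mean_log_ratio u t)%:E = (\int[nu]_x (ln (lik_ratio F u t j x))%:E)%E.
Proof.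
by rewrite /mean_log_ratio fineK// integrable_fin_num//; exact: integrable_ln_lik_ratio.
Qed.

Lemma measurable_mean_log_ratio d1 (S : measurableType d1) (U : S -> nat -> T) t :
  (forall l, measurable_fun [set: S] (U ^~ l)) ->
  measurable_fun [set: S] (fun s => mean_log_ratio (U s) t).
Proof.
move=> mU; apply/measurable_EFinP.
rewrite (_ : _ \o _ = fun s =>
  (\int[nu]_x (ln (lik_ratio F (U s) t j x))%:E)%E); last first.
  by apply/funext => s /=; rewrite mean_log_ratioE.
apply: (@measurable_integral_snd _ _ _ _ _ nu
  (fun z => ln (lik_ratio F (U z.1) t j z.2))).
apply: (@ml _ _ (fun z => U z.1) snd) => // l.
exact: (measurableT_comp (mU l) measurable_fst).
Qed.

(** As the log-ratios are at most [ln C] in absolute value and [1 <= ln C], this choice gives [2 *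
    lambda * (|z| + 1) <= 4 * lambda * ln C = 1], the condition of [expR_softplus_le]. *)
Let lambda := (4 * ln C)^-1.

Let lambda0 : 0 < lambda.
Proof. by rewrite invr_gt0; have := C1; lra. Qed.

Let phi i u x := expR (lambda * mean_log_ratio u i
  - 2 * lambda * ln ((1 + lik_ratio F u i j x) / 2)).

Let phi_le i u x :
  phi i u x <= expR (lambda * mean_log_ratio u i) *
    (1 - lambda * ln (lik_ratio F u i j x)).
Proof.
have r0 : 0 < lik_ratio F u i j x by exact: (lik_ratio_gt0 M0 F0 C1 FC).
rewrite /phi expRD ler_pM2l ?expR_gt0//.
rewrite -{1}[lik_ratio F u i j x]lnK ?posrE//; apply: expR_softplus_le => //.
have := abs_ln_lik_ratio M0 F0 C1 FC u i j x.
set z := `|_| => zC.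
have lC : lambda * (4 * ln C) = 1 by rewrite mulVf// gt_eqF//; have := C1; lra.
have : 0 <= lambda * (2 * ln C - (z + 1)).
  by apply: mulr_ge0; [exact: ltW|have := C1; lra].
by lra.
Qed.

Let mphi i d1 (S : measurableType d1) (U : S -> nat -> T) :
  (forall l, measurable_fun [set: S] (U ^~ l)) ->
  measurable_fun [set: S * T] (fun z => phi i (U z.1) z.2).
Proof.
move=> mU; have mU1 l : measurable_fun [set: S * T] (fun z => U z.1 l).
  exact: (measurableT_comp (mU l) measurable_fst).
apply: measurableT_comp; first exact: measurable_expR.
apply: measurable_funB; apply: measurable_funM => //.
  exact: (@measurable_mean_log_ratio _ _ (fun z => U z.1)).
apply: measurableT_comp; first exact: measurable_ln.
apply: measurable_funM => //; apply: measurable_funD => //.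
exact: (@measurable_lik_ratio _ _ _ _ _ mF _ _ (fun z => U z.1) snd).
Qed.

(** Integrating [phi_le] bounds the integral by [expR (lambda * D) * (1 - lambda * D)], and
    [1 - lambda * D <= expR (- (lambda * D))]. *)
Let int_phi_le1 i u : (\int[nu]_x (phi i u x)%:E <= 1)%E.
Proof.
set D := mean_log_ratio u i; have il := integrable_ln_lik_ratio u i.
have i1 : nu.-integrable [set: T]
    (fun x => (1 - lambda * ln (lik_ratio F u i j x))%:E).
  under eq_fun do rewrite EFinB EFinM.
  apply: integrableB => //; last exact: integrableZl.
  exact: finite_measure_integrable_cst.
have : (\int[nu]_x (phi i u x)%:E <=
    \int[nu]_x ((expR (lambda * D))%:E *
      (1 - lambda * ln (lik_ratio F u i j x))%:E))%E.
  apply: ae_le_integral.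
  - apply/measurable_EFinP; apply: (@measurableT_comp _ _ _ _ _ _
      (fun z => phi i ((fun _ : T => u) z.1) z.2) _ (fun x => (x, x))).
      exact: mphi.
    exact: measurable_fun_pair.
  - by apply: emeasurable_funM => //; have /integrableP[] := i1.
  - by apply: aeW => x; rewrite -EFinM lee_fin phi_le.
move=> /le_trans; apply; rewrite integralZl//.
under eq_integral do rewrite EFinB EFinM.
rewrite integralB//; last 2 first.
- exact: finite_measure_integrable_cst.
- exact: integrableZl.
rewrite integral_cst//= probability_setT mul1e integralZl// -mean_log_ratioE -/D.
rewrite -(EFinM lambda) -EFinB -EFinM lee_fin.
by rewrite -[leRHS](expRxMexpNx_1 (lambda * D)) ler_pM2l ?expR_gt0//;
  exact: expR_ge1Dx.
Qed.

Lemma sequential_deviation delta : 0 < delta ->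
  let G := [set w | \sum_(t < n) mean_log_ratio (Y ^~ w) t <=
    2 * ln M%:R + 4 * ln C * ln (1 / delta)] in
  measurable G /\ ((1 - delta)%:E <= P G)%E.
Proof.
move=> d0 G; set L := ln (1 / delta).
pose S w := \sum_(t < n) mean_log_ratio (Y ^~ w) t.
have mS : measurable_fun [set: Omega] S.
  by apply: measurable_sum => t; apply: measurable_mean_log_ratio => l.
have mG : measurable G.
  rewrite -[G]setTI (_ : G = S @^-1` `]-oo, 2 * ln M%:R + 4 * ln C * L]).
    by apply: mS => //; exact: measurable_itv.
  by apply/seteqP; split=> w; rewrite /G/= in_itv.
split=> //; pose Phi w := \prod_(i < n) phi i (Y ^~ w) (Y i w).
(* Off [G] the sum [S w] exceeds [2 * ln M + 4 * ln C * L]. The softplus terms cost at most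
   [2 * lambda * ln M], and [lambda * (4 * ln C) = 1], so the exponent of [Phi w] is at least
   [L = - ln delta]. *)
have Phi_gt w : ~ G w -> (1 <= (delta * Phi w)%:E)%E.
  move=> /negP; rewrite -ltNge -/(S w) lee_fin => SG.
  have odds0 (i : 'I_n) : 0 < (1 + lik_ratio F (Y ^~ w) i j (Y i w)) / 2.
    by have := lik_ratio_gt0 M0 F0 C1 FC (Y ^~ w) i j (Y i w); lra.
  have lM : \sum_(i < n) ln ((1 + lik_ratio F (Y ^~ w) i j (Y i w)) / 2) <=
      ln M%:R.
    rewrite -ler_expR lnK ?posrE ?ltr0n// expR_sum.
    under eq_bigr do rewrite lnK ?posrE//.
    exact: (prod_lik_ratio_le M0 F0 C1 FC).
  rewrite /Phi /phi -expR_sum sumrB -!mulr_sumr -/(S w).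
  have -> : delta = expR (- L).
    by rewrite /L expRN lnK ?posrE ?divr_gt0// div1r invrK.
  rewrite -expRD -[leLHS]expR0 ler_expR.
  have lC : lambda * (4 * ln C) = 1 by rewrite mulVf// gt_eqF//; have := C1; lra.
  have : 0 <= lambda * (S w - (2 * ln M%:R + 4 * ln C * L)).
    by apply: mulr_ge0; rewrite ?subr_ge0; exact: ltW.
  rewrite mulrBr (mulrDr lambda) (mulrA lambda (4 * _)) lC mul1r.
  move: lM; rewrite -subr_ge0 => /(mulr_ge0 (ltW lambda0)).
  by lra.
have mPhi : measurable_fun [set: Omega] Phi.
  apply: measurable_prod => i _.
  have mphiY : measurable_fun [set: Omega * T]
      (fun z => phi i (fun l => Y l z.1) z.2).
    exact: (@mphi i _ _ (fun w l => Y l w)).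
  have mwY : measurable_fun [set: Omega] (fun w => (w, Y i w)).
    exact: measurable_fun_pair.
  exact: measurableT_comp mphiY mwY.
have PhiE : (\int[P]_w (Phi w)%:E <= 1)%E.
  apply: (sequential_product_le1 YE) => //.
  - by move=> i u x; exact: expR_ge0.
  - move=> i u v uv x.
    by rewrite /phi /mean_log_ratio /lik_ratio (weight_ext F uv).
have GD : (P (~` G) <= delta%:E)%E.
  (* Markov's inequality: the indicator of the complement of [G] is at most [delta * Phi]. *)
  apply: (@le_trans _ _ (\int[P]_w (delta%:E * (Phi w)%:E))%E); last first.
    rewrite ge0_integralZl_EFin//; last exact: ltW.
    - by rewrite -[leRHS]mule1; apply: lee_wpmul2l => //; rewrite lee_fin ltW.
    - by move=> w _; rewrite lee_fin; apply: prodr_ge0 => i _; exact: expR_ge0.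
    - exact/measurable_EFinP.
  rewrite -[X in P X]setIT -integral_indic//; last exact: measurableC.
  apply: ge0_le_integral => //.
  - by apply/measurable_EFinP/measurable_indic; exact: measurableC.
  - by apply/measurable_EFinP; exact: measurable_funM.
  - move=> w _; rewrite indicE; case: (boolP (w \in _)) => [/[!inE] Gw|_].
      exact: Phi_gt.
    rewrite -EFinM lee_fin mulr_ge0 ?(ltW d0)//.
    by apply: prodr_ge0 => i _; exact: expR_ge0.
rewrite -[G]setCK probability_setC; last exact: measurableC.
by rewrite EFinB; apply: leeB.
Qed.

End sequential_deviation.

(** * Densities and the Kullback-Leibler divergence *)

(** Jensen's inequality from the tangent of [ln] at the mean [a]; the linear terms [m t / a - 1] sum
    to zero. *)
Lemma le_ln_mean (R : realType) n (m : 'I_n -> R) : (0 < n)%N ->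
  (forall t, 0 < m t) ->
  n%:R^-1 * (\sum_t ln (m t)) <= ln (n%:R^-1 * \sum_t m t).
Proof.
move=> n0 m0; set a := n%:R^-1 * \sum_t m t.
have nR : 0 < n%:R :> R by rewrite ltr0n.
have a0 : 0 < a.
  rewrite mulr_gt0 ?invr_gt0//.
  apply: (@lt_le_trans _ _ (m (Ordinal n0))) => //.
  by rewrite (bigD1 (Ordinal n0))//= lerDl sumr_ge0// => i _; exact: ltW.
have tangent t : ln (m t) <= ln a + (m t / a - 1).
  rewrite -lerBlDl -ln_div ?posrE//.
  have := @le_ln1Dx R (m t / a - 1); rewrite subrKC; apply.
  by have := divr_gt0 (m0 t) a0; lra.
rewrite ler_pdivrMl//; apply: le_trans (ler_sum _ (fun t _ => tangent t)) _.
rewrite big_split/= sumr_const card_ord sumrB -mulr_suml sumr_const card_ord.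
have -> : \sum_t m t = n%:R * a by rewrite /a mulrA divff ?mul1r// gt_eqF.
by rewrite mulfK ?gt_eqF// subrr addr0 mulr_natl.
Qed.

Section density_KL.
Context d (T : measurableType d) (R : realType) (mu : {measure set T -> \bar R}).
Local Open Scope ereal_scope.

Lemma density_mixture n (w : 'I_n -> R) (q : 'I_n -> T -> R) :
  (forall j, density mu (q j)) -> (forall j, (0 <= w j)%R) ->
  (\sum_j w j = 1)%R -> density mu (mixture w q).
Proof.
move=> dq w0 w1; split.
- by apply: measurable_sum => j; apply: measurable_funM => //; have [] := dq j.
- by move=> x; apply: sumr_ge0 => j _; apply: mulr_ge0 => //; have [_ + _] := dq j.
under eq_integral do rewrite -sumEFin.
rewrite ge0_integral_sum//; last 2 first.
- move=> j; apply/measurable_EFinP/measurable_funM => //.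
  by have [] := dq j.
- by move=> j x _; rewrite lee_fin mulr_ge0//; have [_ + _] := dq j.
rewrite -w1 -sumEFin; apply: eq_bigr => j _.
have [mq q0 q1] := dq j.
under eq_integral do rewrite EFinM.
rewrite ge0_integralZl_EFin ?q1 ?mule1//.
- by move=> x _; rewrite lee_fin.
- exact/measurable_EFinP.
Qed.

Lemma law_of_density0P (q : T -> R) A : density mu q -> measurable A ->
  law_of_density mu q A = 0 <-> {ae mu, forall x, A x -> q x = 0%R}.
Proof.
move=> [mq q0 _] mA.
have mqA : measurable_fun A (fun x => (q x)%:E).
  by apply/measurable_EFinP; exact: measurable_funTS.
have := ae_eq_integral_abs mu mA mqA.
rewrite /law_of_density; under eq_integral do rewrite gee0_abs ?lee_fin//.
move=> ->; split; apply: filterS => x /= h Ax; first by have /= [] := h Ax.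
by rewrite h.
Qed.

(** Where [r] vanishes so does [q], hence the law of [q] is dominated by that of [r]; transitivity
    concludes. *)
Lemma dominates_of_gt0 (p q r : T -> R) : density mu q -> density mu r ->
  (forall x, (0 < q x)%R -> (0 < r x)%R) ->
  law_of_density mu p `<< law_of_density mu q ->
  law_of_density mu p `<< law_of_density mu r.
Proof.
move=> dq dr qr; move=> pq; apply: (null_dominates_trans pq) => A rA B mB BA.
have /(law_of_density0P dr mB) h : law_of_density mu r B = 0 by exact: rA.
apply/law_of_density0P => //.
apply: filterS h => x h Bx.
have [_ q0 _] := dq; have := q0 x; rewrite le_eqVlt => /predU1P[//|/qr].
by rewrite h// ltxx.
Qed.

(** Domination is applied to the set where [q] vanishes, which has mass 0 under the law of [q]. *)
Lemma dominates_ae_gt0 (p q : T -> R) : density mu p -> density mu q ->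
  law_of_density mu p `<< law_of_density mu q ->
  {ae mu, forall x, p x = 0%R \/ (0 < q x)%R}.
Proof.
move=> dp dq pq; have [mq q0 _] := dq.
have mA : measurable [set x | q x = 0%R].
  rewrite -[X in measurable X]setTI.
  exact: (mq measurableT [set 0%R] (measurable_set1 _)).
have : law_of_density mu p [set x | q x = 0%R] = 0.
  apply: (pq [set x | q x = 0%R]) => // B mB BA.
  by apply/law_of_density0P => //; exact: aeW.
move=> /(law_of_density0P dp mA); apply: filterS => x h.
have := q0 x; rewrite le_eqVlt => /predU1P[/esym/h|]; by [left|right].
Qed.

Lemma KL_integrand_measurable (p q : T -> R) : density mu p -> density mu q ->
  measurable_fun [set: T] (fun x => (p x * ln (p x / q x))%R).
Proof.
move=> [mp _ _] [mq _ _]; apply: measurable_funM => //.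
apply: measurableT_comp; first exact: measurable_ln.
by apply: measurable_funM => //; exact: measurable_funV.
Qed.

(** For positive arguments, [ln x <= x - 1] at [x = q / p] gives [p * ln (p / q) >= p - q]. *)
Lemma KL_integrand_ge (p q : R) : (0 <= p)%R -> (0 <= q)%R ->
  (- q <= p * ln (p / q))%R.
Proof.
rewrite le_eqVlt => /predU1P[<- q0|p0]; first by rewrite mul0r oppr_le0.
(* For [q = 0] the quotient is 0 by default and [ln 0 = 0], so both sides vanish. *)
rewrite le_eqVlt => /predU1P[<-|q0].
  by rewrite invr0 mulr0 ln0// mulr0 oppr0.
have : (ln (q / p) <= q / p - 1)%R.
  have := @le_ln1Dx R (q / p - 1); rewrite subrKC; apply.
  by have := divr_gt0 q0 p0; lra.
rewrite -[(q / p)%R]invf_div lnV ?posrE ?divr_gt0// => h.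
have : (p * (- ln (p / q)) <= p * ((p / q)^-1 - 1))%R by rewrite ler_pM2l.
rewrite invf_div mulrBr [X in (_ <= X - _)%R]mulrC divfK ?gt_eqF//.
by lra.
Qed.

(** The negative part is at most [q] and has integral at most 1; an infinite integral of the
    positive part would therefore make the divergence infinite. *)
Lemma KL_integrable (p q : T -> R) : density mu p -> density mu q ->
  KL mu p q < +oo ->
  mu.-integrable [set: T] (fun x => (p x * ln (p x / q x))%:E).
Proof.
move=> dp dq; rewrite /KL; case: asboolP => [_|_ //].
have mf : measurable_fun [set: T] (fun x => (p x * ln (p x / q x))%:E).
  by apply/measurable_EFinP; exact: KL_integrand_measurable.
have [[_ p0 _] [mq q0 q1]] := (dp, dq).
set f := (fun x => _) in mf *.
have fneg : \int[mu]_x f^\- x < +oo.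
  apply: (@le_lt_trans _ _ (\int[mu]_x (q x)%:E)); last by rewrite q1 ltry.
  apply: ge0_le_integral => //; first exact: measurable_funeneg.
  - exact/measurable_EFinP.
  - move=> x _; rewrite funenegE ge_max; apply/andP; split; last by rewrite lee_fin.
    by rewrite /f -EFinN lee_fin lerNl; exact: KL_integrand_ge.
rewrite integralE => fpos; apply/integrableP; split=> //.
rewrite -/(abse \o f) fune_abse ge0_integralD//;
  [|exact: measurable_funepos|exact: measurable_funeneg].
rewrite lte_add_pinfty// ltNge leye_eq; apply/negP => /eqP fy.
move: fpos; rewrite fy -(fineK (x := \int[mu]_x f^\- x)) ?addye//.
by rewrite ge0_fin_numE// integral_ge0.
Qed.

(** Where [ps] and [p] are positive, [ln (ps / q) = ln (ps / p) + ln (p / q)] and the last term is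
    at most [g]. Where [ps] vanishes every integrand is 0, and by domination the remaining points
    form a null set. *)
Lemma KL_le (ps p q g : T -> R) :
  density mu ps -> density mu p -> density mu q ->
  mu.-integrable [set: T] (fun x => (ps x * g x)%:E) ->
  (forall x, (0 < p x)%R -> (0 < q x /\ ln (p x / q x) <= g x)%R) ->
  KL mu ps p < +oo ->
  KL mu ps q <= KL mu ps p + \int[mu]_x (ps x * g x)%:E.
Proof.
move=> ds dp dq ig pq Koo; have iK := KL_integrable ds dp Koo.
have psp : law_of_density mu ps `<< law_of_density mu p.
  by move: Koo; rewrite /KL; case: asboolP.
have psq : law_of_density mu ps `<< law_of_density mu q.
  by apply: dominates_of_gt0 psp => // x /pq[].
rewrite /KL !asboolT// -integralD//; apply: ae_le_integral.
- by apply/measurable_EFinP; exact: KL_integrand_measurable.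
- have /integrableP[mK _] := iK; have /integrableP[mg _] := ig.
  exact: emeasurable_funD.
apply: filterS (dominates_ae_gt0 ds dp psp) => x.
have [_ s0 _] := ds; have := s0 x; rewrite le_eqVlt => /predU1P[<- _|sx].
  by rewrite !mul0r adde0.
move=> [s0'|px]; first by rewrite s0' ltxx in sx.
have [qx lg] := pq x px; rewrite -EFinD lee_fin -mulrDr ler_pM2l//.
rewrite (_ : ps x / q x = (ps x / p x) * (p x / q x))%R; last first.
  by field; rewrite !gt_eqF.
by rewrite lnM ?posrE ?divr_gt0// lerD2l.
Qed.

End density_KL.

(** * The estimator *)

Lemma bigmine_attained (R : realType) M (a : 'I_M -> \bar R) :
  (\big[mine/+oo]_(j < M) a j = +oo \/
   exists j, \big[mine/+oo]_(j < M) a j = a j)%E.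
Proof.
elim/big_ind: _ => [|x y hx hy|j _]; [by left| |by right; exists j].
by rewrite minEle; case: ifP.
Qed.

Section estimator.
Context d (T : measurableType d) (R : realType) (mu : {measure set T -> \bar R}).
Variables (M n : nat) (p : 'I_M -> T -> R).
Hypotheses (M2 : (2 <= M)%N) (n0 : (0 < n)%N) (dp : forall j, density mu (p j)).

Let M0 : (0 < M)%N. Proof. exact: ltnW. Qed.
Let nR : 1 <= n%:R :> R. Proof. by rewrite ler1n. Qed.
Let MR : 2 <= M%:R :> R. Proof. by rewrite ler_nat. Qed.

(** The value for which the smoothing costs at most [2 * alpha = 1 / n] in the logarithm. *)
Let alpha : R := (2 * n%:R)^-1.

Let alphan : alpha * (2 * n%:R) = 1.
Proof. by rewrite mulVf// gt_eqF//; move: nR; lra. Qed.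

Let alpha0 : 0 < alpha.
Proof. by rewrite invr_gt0; move: nR; lra. Qed.

Let alpha2 : alpha <= 1 / 2.
Proof.
have : 0 <= alpha * (n%:R - 1) by rewrite mulr_ge0 ?subr_ge0// ltW.
by move: alphan; lra.
Qed.

(** Written as one mixture of the [p k] so that [density_mixture] applies directly. *)
Definition smoothed (j : 'I_M) : T -> R :=
  mixture (fun k => (1 - alpha) * (k == j)%:R + alpha / M%:R) p.

(* The update of the weights divides by the mixture; on the set where all the
   densities vanish they are replaced by 1 so that this is never a division by 0. *)
Definition positive_smoothed (j : 'I_M) (x : T) : R :=
  if \sum_k p k x == 0 then 1 else smoothed j x.

(** The weights are computed from the everywhere positive functions, but the functions averaged are
    the [smoothed] ones, which are densities. *)
Definition estimator (u : nat -> T) : T -> R :=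
  mixture (fun=> n%:R^-1)
    (fun t : 'I_n => mixture (weight positive_smoothed u t) smoothed).

Let p0 j x : 0 <= p j x. Proof. by have [_ + _] := dp j. Qed.
Let mp j : measurable_fun [set: T] (p j). Proof. by have [] := dp j. Qed.

Lemma smoothedE j x :
  smoothed j x = (1 - alpha) * p j x + alpha / M%:R * \sum_k p k x.
Proof.
rewrite /smoothed /mixture mulr_sumr.
under eq_bigr do rewrite mulrDl.
rewrite big_split/=; congr (_ + _).
rewrite (bigD1 j)//= eqxx mulr1 big1 ?addr0// => k /negbTE->.
by rewrite mulr0 mul0r.
Qed.

(** The inverse of [alpha / M], the least coefficient of any [p k] in a smoothed density. *)
Let C : R := 2 * n%:R * M%:R.

(** Here [C >= 4] and [ln 4 = 2 * ln 2], while [ln 2 >= 1 / 2] is the inequality [ln (1 + x) <= x]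
    at [x = - 1 / 2]. *)
Lemma ln_2nM_ge1 : 1 <= ln C.
Proof.
have C4 : 2 * 2 <= C.
  have : 0 <= (n%:R - 1 : R) * M%:R by rewrite mulr_ge0 ?subr_ge0.
  by rewrite /C; move: MR; lra.
have l2 : 1 / 2 <= ln 2 :> R.
  have := @le_ln1Dx R (- (1 / 2)).
  rewrite (_ : 1 + - (1 / 2) = 2^-1); last by field.
  rewrite lnV ?posrE// => /(_ _); lra.
have : ln (2 * 2) <= ln C by rewrite ler_ln ?posrE//; lra.
by rewrite lnM ?posrE//; lra.
Qed.

Let s0 j x : 0 < \sum_k p k x -> 0 < smoothed j x.
Proof.
move=> sx; rewrite smoothedE; apply: ltr_wpDl.
  by rewrite mulr_ge0// subr_ge0; move: alpha2; lra.
by rewrite mulr_gt0// divr_gt0// ltr0n.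
Qed.

Let sum0 x : 0 <= \sum_k p k x. Proof. exact: sumr_ge0. Qed.

Lemma positive_smoothed_gt0 j x : 0 < positive_smoothed j x.
Proof.
rewrite /positive_smoothed; case: eqVneq => // sx.
by rewrite s0// lt0r sx sum0.
Qed.

(** With [S] the sum of all densities at [x], every smoothed density lies between [S / C] and [S].
    If [S = 0] both functions are 1 and [C >= 1]. *)
Lemma positive_smoothed_le j k x :
  positive_smoothed j x <= C * positive_smoothed k x.
Proof.
rewrite /positive_smoothed; case: eqP => [_|_].
  rewrite mulr1 leNgt; apply/negP => C_lt1.
  have : ln C <= 0 by apply: ln_le0; exact: ltW.
  by move: ln_2nM_ge1; lra.
have CaM : C * (alpha / M%:R) = 1.
  by rewrite /C -[RHS]alphan; field; rewrite pnatr_eq0 -lt0n.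
have pj : p j x <= \sum_k p k x by rewrite (bigD1 j)//= lerDl sumr_ge0.
rewrite !smoothedE mulrDr [C * (_ / _ * _)]mulrA CaM mul1r.
set S := \sum_k _ in pj *; have a1 : 0 <= 1 - alpha by move: alpha2; lra.
have : 0 <= C * ((1 - alpha) * p k x) by rewrite !mulr_ge0.
have : (1 - alpha) * p j x <= (1 - alpha) * S by exact: ler_wpM2l.
have : alpha / M%:R * S <= alpha * S.
  apply: ler_wpM2r; [exact: sum0|apply: ler_piMr; first exact: ltW].
  by rewrite invf_le1; move: MR; lra.
lra.
Qed.

Let dsmoothed j : density mu (smoothed j).
Proof.
apply: density_mixture => // [k|].
  rewrite addr_ge0 ?divr_ge0 ?mulr_ge0 ?subr_ge0// ?ltW//; move: alpha2; lra.
rewrite big_split/= sumr_const card_ord -[_ *+ M]mulr_natr divfK; last first.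
  by rewrite pnatr_eq0 -lt0n.
rewrite -mulr_sumr (bigD1 j)//= eqxx big1 ?addr0 ?mulr1 ?subrK// => k /negbTE->.
by [].
Qed.

Let msmoothed j : measurable_fun [set: T] (smoothed j).
Proof. by have [] := dsmoothed j. Qed.

Lemma measurable_positive_smoothed j :
  measurable_fun [set: T] (positive_smoothed j).
Proof.
apply: measurable_fun_ifT => //.
by apply: measurable_fun_eqr => //; exact: measurable_sum.
Qed.

Let W := weight positive_smoothed.

Let W_simplex u t : (forall j, 0 <= W u t j) /\ \sum_j W u t j = 1.
Proof.
exact: (weight_simplex M0 positive_smoothed_gt0 ln_2nM_ge1
  positive_smoothed_le).
Qed.

Lemma estimator_density u : density mu (estimator u).
Proof.
apply: density_mixture => [t|//|].
  by have [w0 w1] := W_simplex u t; exact: density_mixture.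
by rewrite sumr_const card_ord -[_ *+ n]mulr_natr mulVf// pnatr_eq0 -lt0n.
Qed.

Lemma estimator_ext u v : (forall t, (t < n)%N -> u t = v t) ->
  estimator u = estimator v.
Proof.
move=> uv; apply/funext => x; apply: eq_bigr => t _; congr (_ * mixture _ _ _).
by apply: weight_ext => l lt; apply: uv; exact: ltn_trans lt _.
Qed.

Lemma measurable_estimator d1 (S : measurableType d1) (U : S -> nat -> T) :
  (forall l, measurable_fun [set: S] (U ^~ l)) ->
  measurable_fun [set: S * T] (fun z => estimator (U z.1) z.2).
Proof.
move=> mU; apply: measurable_sum => t; apply: measurable_funM => //.
apply: (@measurable_mixture _ _ _ _ _ msmoothed _ _
  (fun z : S * T => W (U z.1) t) snd) => // j.
apply: (@measurable_weight _ _ _ _ _ measurable_positive_smoothed _ _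
  (fun z : S * T => U z.1)) => l.
exact: (measurableT_comp (mU l) measurable_fst).
Qed.

Let estimatorE u x :
  estimator u x = n%:R^-1 * \sum_(t < n) mixture (W u t) smoothed x.
Proof. by rewrite mulr_sumr. Qed.

Lemma estimator_gt0 u j x : 0 < p j x ->
  (forall t, 0 < mixture (W u t) smoothed x) /\ 0 < estimator u x.
Proof.
move=> pj.
have S0 : 0 < \sum_k p k x by rewrite (bigD1 j)//= ltr_wpDr// sumr_ge0.
have W0 t : 0 < mixture (W u t) smoothed x.
  have [w0 w1] := W_simplex u t; rewrite lt0r sumr_ge0 ?andbT; last first.
    by move=> k _; rewrite mulr_ge0// ltW// s0.
  apply/negP => /eqP /psumr_eq0P => h.
  have : \sum_k W u t k = 0.
    apply: big1 => k _.
    have := h (fun k _ => mulr_ge0 (w0 k) (ltW (s0 k S0))) k isT.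
    by move/eqP; rewrite mulf_eq0 (gt_eqF (s0 k S0)) orbF => /eqP.
  by rewrite w1 => /eqP; rewrite oner_eq0.
split=> //; rewrite estimatorE mulr_gt0//.
  by rewrite invr_gt0 ltr0n.
by rewrite (bigD1 (Ordinal n0))//= ltr_wpDr// ?sumr_ge0// => t _; exact/ltW/W0.
Qed.

(** Two losses add up: smoothing costs [ln (p j x / smoothed j x) <= (1 - alpha)^-1 - 1 <= 2 * alpha
    = 1 / n], and by concavity the logarithm of the averaged mixtures is at least the average of
    their logarithms. *)
Lemma ln_div_estimator_le u j x : 0 < p j x ->
  ln (p j x / estimator u x) <=
  n%:R^-1 * (1 + \sum_(t < n) ln (lik_ratio positive_smoothed u t j x)).
Proof.
move=> pj; have [W0 e0] := estimator_gt0 u pj.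
have S0 : 0 < \sum_k p k x by rewrite (bigD1 j)//= ltr_wpDr// sumr_ge0.
(* Since [p j x > 0], the point lies outside the exceptional set, and the ratios driving the weights
   are those of the true smoothed densities. *)
have FE k : positive_smoothed k x = smoothed k x.
  by rewrite /positive_smoothed gt_eqF.
have rE t : lik_ratio positive_smoothed u t j x =
    smoothed j x / mixture (W u t) smoothed x.
  by rewrite /lik_ratio FE; congr (_ / _); apply: eq_bigr => k _; rewrite FE.
under eq_bigr do rewrite rE ln_div ?posrE ?s0//.
rewrite sumrB sumr_const card_ord -[ln (smoothed j x) *+ n]mulr_natl.
rewrite mulrDr mulrBr.
rewrite mulr1 mulrA mulVf ?mul1r; last by rewrite pnatr_eq0 -lt0n.
rewrite ln_div ?posrE//.
have := le_ln_mean n0 W0; rewrite -estimatorE => lm.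
have : ln (p j x) - ln (smoothed j x) <= n%:R^-1.
  rewrite -ln_div ?posrE ?s0//.
  have a1 : 0 < 1 - alpha by move: alpha2; lra.
  have : p j x / smoothed j x <= (1 - alpha)^-1.
    rewrite ler_pdivrMr ?s0// ler_pdivlMl// smoothedE lerDl.
    by rewrite mulr_ge0 ?divr_ge0// ltW.
  rewrite -ler_ln ?posrE ?divr_gt0 ?s0 ?invr_gt0// => /le_trans; apply.
  have := @le_ln1Dx R ((1 - alpha)^-1 - 1); rewrite subrKC => h.
  have a2 : (1 - alpha)^-1 <= 1 + 2 * alpha.
    have : 0 <= alpha * (1 - 2 * alpha).
      by apply: mulr_ge0; [exact: ltW|move: alpha2; lra].
    by rewrite -[_^-1]mul1r ler_pdivrMr//; lra.
  have -> : n%:R^-1 = 2 * alpha.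
    by rewrite /alpha; field; rewrite pnatr_eq0 -lt0n.
  have a3 : 0 < (1 - alpha)^-1 by rewrite invr_gt0.
  have {h} := h _; lra.
lra.
Qed.

(** * Excess risk of the estimator and its measurability in the sample *)

Section risk.
Variables (nu : probability T R) (ps : T -> R).
Hypotheses (dps : density mu ps).
Hypothesis nuE : forall A, measurable A -> nu A = law_of_density mu ps A.

(** [KL_le] is applied with the pointwise bound of [ln_div_estimator_le] as [g]; passing from [mu]
    with density [ps] to [nu] turns the integral of each log-ratio into its conditional mean. *)
Lemma KL_estimator_le j u : (KL mu ps (p j) < +oo)%E ->
  (KL mu ps (estimator u) <= KL mu ps (p j) + (n%:R^-1 *
    (1 + \sum_(t < n) mean_log_ratio nu positive_smoothed j u t))%:E)%E.
Proof.
move=> Koo; have [mps ps0 ps1] := dps.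
pose g x := n%:R^-1 *
  (1 + \sum_(t < n) ln (lik_ratio positive_smoothed u t j x)).
have il t := integrable_ln_lik_ratio nu M0 positive_smoothed_gt0
  measurable_positive_smoothed ln_2nM_ge1 positive_smoothed_le j u t.
have gE x : (g x)%:E = (n%:R^-1%:E * (1%:E +
    \sum_(t < n) (ln (lik_ratio positive_smoothed u t j x))%:E))%E.
  by rewrite /g EFinM EFinD sumEFin.
have i1 : nu.-integrable [set: T] (fun=> 1%:E).
  exact: finite_measure_integrable_cst.
have isum : nu.-integrable [set: T] (fun x =>
    \sum_(t < n) (ln (lik_ratio positive_smoothed u t j x))%:E)%E.
  exact: integrable_sum.
have ig : nu.-integrable [set: T] (fun x => (g x)%:E).
  by under eq_fun do rewrite gE; apply: integrableZl => //; exact: integrableD.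
have /integrableP[mgE goo] := ig; have /measurable_EFinP mg := mgE.
have <- : (\int[mu]_x (ps x * g x)%:E)%E = (n%:R^-1 *
    (1 + \sum_(t < n) mean_log_ratio nu positive_smoothed j u t))%:E.
  rewrite (change_of_density mps ps0 nuE mg).
  under eq_integral do rewrite gE.
  rewrite integralZl//; last exact: integrableD.
  rewrite integralD// integral_cst// mul1e integral_sum//.
  rewrite EFinM EFinD -sumEFin.
  under [in RHS]eq_bigr do rewrite (mean_log_ratioE nu M0 positive_smoothed_gt0
    measurable_positive_smoothed ln_2nM_ge1 positive_smoothed_le).
  by congr (_ * (_ + _))%E; exact: probability_setT.
apply: KL_le => //; first exact: estimator_density.
  apply/integrableP; split; first by apply/measurable_EFinP; exact: measurable_funM.
  move: goo; rewrite (ge0_change_of_density mps ps0 nuE)//; last first.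
    exact: measurableT_comp.
  apply: le_lt_trans; rewrite le_eqVlt; apply/predU1P; left.
  apply: eq_integral => x _.
  by rewrite EFinM abseM (gee0_abs (x := (ps x)%:E)) ?lee_fin// muleC.
move=> x pj; split; last exact: ln_div_estimator_le.
by have [] := estimator_gt0 u pj.
Qed.

(** A finite divergence from [p j] forces domination by the estimator for every sample, so the
    divergence is always given by its integral. Rewriting it against the probability [nu] gives
    access to Tonelli, since [mu] is not assumed sigma-finite. *)
Lemma measurable_KL_estimator j d1 (S : measurableType d1) (U : S -> nat -> T) :
  (KL mu ps (p j) < +oo)%E ->
  (forall l, measurable_fun [set: S] (U ^~ l)) ->
  measurable_fun [set: S] (fun s => KL mu ps (estimator (U s))).
Proof.
move=> Koo mU; have [mps ps0 _] := dps.
have psp : law_of_density mu ps `<< law_of_density mu (p j).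
  by move: Koo; rewrite /KL; case: asboolP.
have mL : measurable_fun [set: S * T]
    (fun z => ln (ps z.2 / estimator (U z.1) z.2)).
  apply: measurableT_comp; first exact: measurable_ln.
  apply: measurable_funM; first exact: (measurableT_comp mps measurable_snd).
  by apply: measurable_funV; exact: measurable_estimator.
rewrite (_ : (fun s => _) =
    fun s => (\int[nu]_x (ln (ps x / estimator (U s) x))%:E)%E).
  exact: (@measurable_integral_snd _ _ _ _ _ nu _ mL).
apply/funext => s; rewrite /KL asboolT.
  apply: (change_of_density mps ps0 nuE).
  have [me _ _] := estimator_density (U s).
  apply: measurableT_comp; first exact: measurable_ln.
  by apply: measurable_funM => //; exact: measurable_funV.
apply: dominates_of_gt0 psp => //; first exact: estimator_density.
by move=> x pj; have [] := estimator_gt0 (U s) pj.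
Qed.

End risk.

End estimator.

(** * From the i.i.d. sample to the oracle inequality *)

(** Mutual independence is used for the subfamily of indices below [k]. Reindexing by naturals
    through [inord] matches the sequential sections, and [k <= n.+1] keeps [inord] faithful. *)
Lemma iid_box (R : realType) d d' (T : measurableType d)
    (Omega : measurableType d') (mu : {measure set T -> \bar R})
    (P : probability Omega R) (n : nat) (ps : T -> R)
    (X : 'I_n.+1 -> {RV P >-> T}) : iid_with_density mu ps X ->
  forall k (A : nat -> set T), (k <= n.+1)%N -> (forall i, measurable (A i)) ->
  P [set w | forall i, (i < k)%N -> A i (X (inord i) w)] =
  (\prod_(i < k) distribution P (X ord0) (A i))%E.
Proof.
move=> [ind law] k A kn mA.
have := ind (finset (fun i : 'I_n.+1 => i < k)%N) (fun i => A i) (fun i _ => mA i).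
rewrite (_ : \bigcap_(i in _) _ =
    [set w | forall i, (i < k)%N -> A i (X (inord i) w)]); last first.
  apply/seteqP; split=> w /= h.
    move=> i ik; have := h (inord i); rewrite /= inE inordK; first exact.
    exact: leq_trans ik kn.
  by move=> i; rewrite /= inE => /h; rewrite inord_val.
move=> ->; rewrite (big_ord_widen _ (fun i => distribution P (X ord0) (A i)) kn).
apply: eq_big => [i|i _]; first by rewrite inE.
exact: etrans (law i _ (mA i)) (esym (law ord0 _ (mA i))).
Qed.

Theorem proposition3 (R : realType) (d : measure_display)
    (T : measurableType d) (mu : {measure set T -> \bar R})
    (M n : nat) (hM : (2 <= M)%N) (hn : (1 <= n)%N)
    (p : 'I_M -> T -> R) (hp : forall j, density mu (p j)) :
  exists phat : n.-tuple T -> T -> R,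
    density_estimator mu phat /\
    forall delta : R, 0 < delta <= 1 / 2 ->
    forall pstar : T -> R, density mu pstar ->
    forall (d' : measure_display) (Omega : measurableType d')
           (P : probability Omega R) (X : 'I_n -> {RV P >-> T}),
      iid_with_density mu pstar X ->
      let E := [set w : Omega |
        (KL mu pstar (phat [tuple X i w | i < n]) <=
         \big[mine/+oo]_(j < M) KL mu pstar (p j) +
         (19 * ln (2 * n%:R * M%:R) * ln (1 / delta) / n%:R)%:E)%E] in
      measurable E /\ ((1 - delta)%:E <= P E)%E.
Proof.
case: n hn => [//|n] hn.
(* The witness does not mention [delta]. The sample is continued by [point], and [estimator_ext]
   shows that only its entries below the sample size are read. *)
exists (fun s => estimator n.+1 p (nth point s)); split.
  by move=> s; exact: estimator_density.
move=> delta /andP[delta0 delta2] ps dps d' Omega P X iidX E.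
pose nu := distribution P (X ord0); pose Y i := X (inord i).
have YE := iid_box iidX.
have nuE A : measurable A -> nu A = law_of_density mu ps A := iidX.2 ord0 A.
have phatE w : estimator n.+1 p (nth point [tuple X i w | i < n.+1]) =
    estimator n.+1 p (Y ^~ w).
  apply: estimator_ext => t tn; rewrite (nth_mktuple _ _ (Ordinal tn)) /Y.
  by congr (X _ w); apply/val_inj; rewrite /= inordK.
(* If every divergence is infinite, so is the right-hand side, and [E] is the whole space. *)
have [minoo|minlt] := eqVneq (\big[mine/+oo]_(j < M) KL mu ps (p j))%E +oo%E.
  have -> : E = setT by apply/seteqP; split=> // w _; rewrite /E/= minoo addye// leey.
  by split=> //; rewrite probability_setT lee_fin; lra.
have [minoo|[j minj]] := bigmine_attained (fun j => KL mu ps (p j)).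
  by rewrite minoo eqxx in minlt.
have Koo : (KL mu ps (p j) < +oo)%E by rewrite -minj ltey.
have mY i : measurable_fun [set: Omega] (Y i) by exact: measurable_funP.
have mE : measurable E.
  rewrite /E minj; under eq_set do rewrite phatE.
  rewrite -[X in measurable X]setTI; apply: emeasurable_fun_infty_c => //.
  exact: (measurable_KL_estimator hM hn hp dps nuE Koo).
split=> //; pose L := ln (1 / delta); pose B : R := ln (2 * n.+1%:R * M%:R).
have B1 : 1 <= B by exact: ln_2nM_ge1.
(* From [ln delta <= delta - 1] and [delta <= 1 / 2]. *)
have L2 : 1 / 2 <= L.
  have := @le_ln1Dx R (delta - 1); rewrite subrKC /L (div1r delta) lnV ?posrE// => h.
  by have {h} := h _; lra.
have MB : ln M%:R <= B.
  have M0 : (0 < M)%N by exact: ltnW.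
  rewrite ler_ln ?posrE ?mulr_gt0 ?ltr0n//.
  by rewrite -natrM -natrM ler_nat leq_pmull.
have [mG PG] := sequential_deviation YE (ltnW hM)
  (positive_smoothed_gt0 hM hn hp) (measurable_positive_smoothed hM hn hp)
  (ln_2nM_ge1 R hM hn) (positive_smoothed_le hM hn hp) j delta0.
apply: (le_trans PG); apply: le_measure; rewrite ?inE// => w Gw.
rewrite /E /mkset phatE minj.
apply: le_trans (KL_estimator_le hM hn hp dps nuE (Y ^~ w) Koo) _.
apply: leeD => //; rewrite lee_fin [leRHS]mulrC; apply: ler_wpM2l.
  by rewrite invr_ge0.
(* By [1 <= B], [ln M <= B] and [1 / 2 <= L], one gets [1 + 2 * ln M <= 3 * B <= 6 * B * L]; adding
   [4 * B * L] gives [10 * B * L], within the allowed [19 * B * L]. *)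
have BL : 0 <= B * (L - 1 / 2) by rewrite mulr_ge0 ?subr_ge0//; lra.
move: Gw; rewrite /mkset -/L -/B; set S := \sum_(_ < _) _.
by lra.
Qed.
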